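(* Let $\rho: L^1(\mathbb{R}^d)\to\mathbb{C}$ be a linear form satisfying the Taylor compatibility condition (T) stated in the context. Let $\lambda: CS^{\notin\mathbb{Z}}_{\rm c.c}(\mathbb{R}^d)\to\mathbb{C}$ be a linear form which coincides with $\rho$ on $CS^{\notin\mathbb{Z}}_{\rm c.c}(\mathbb{R}^d)\cap CS^{<-d}_{\rm c.c}(\mathbb{R}^d)$. If $\lambda$ is either $\mathbb{Z}^d$-translation invariant or $\mathbb{R}^d$-translation invariant, then $\lambda$ is entirely determined by its restriction $\rho$; that is, any two linear forms on $CS^{\notin\mathbb{Z}}_{\rm c.c}(\mathbb{R}^d)$ which coincide with the same $\rho$ on $CS^{\notin\mathbb{Z}}_{\rm c.c}(\mathbb{R}^d)\cap CS^{<-d}_{\rm c.c}(\mathbb{R}^d)$ and are both $\mathbb{Z}^d$-translation invariant (resp. both $\mathbb{R}^d$-translation invariant) are equal.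
   Context: Symbols. For $a\in\mathbb{C}$, $\mathcal{S}^a_{\rm c.c}(\mathbb{R}^d)$ is the set of smooth functions $\sigma$ on $\mathbb{R}^d$ such that for every multiindex $\beta$ there is $C_\beta$ with $|\partial^\beta\sigma(x)|\le C_\beta(1+|x|)^{{\rm Re}(a)-|\beta|}$. $CS^a_{\rm c.c}(\mathbb{R}^d)\subset\mathcal{S}^a_{\rm c.c}(\mathbb{R}^d)$ is the set of classical symbols of order $a$ with constant coefficients: those $\sigma$ such that for every $N$, $\sigma=\sum_{j=0}^{N-1}\chi\,\sigma_{a-j}+\sigma_{(N)}$ with $\sigma_{a-j}$ positively homogeneous of degree $a-j$ (smooth away from $0$), $\sigma_{(N)}\in\mathcal{S}^{a-N}_{\rm c.c}(\mathbb{R}^d)$, and $\chi$ a smooth cut-off function vanishing near $0$ and equal to $1$ outside the unit ball. Set $CS^{<-d}_{\rm c.c}(\mathbb{R}^d)=\bigcup_{{\rm Re}(a)<-d}CS^a_{\rm c.c}(\mathbb{R}^d)$ and $CS^{\notin\mathbb{Z}}_{\rm c.c}(\mathbb{R}^d)=\bigcup_{a\in\mathbb{C}\setminus\mathbb{Z}}CS^a_{\rm c.c}(\mathbb{R}^d)$. A ''linear form'' on the set $CS^{\notin\mathbb{Z}}_{\rm c.c}(\mathbb{R}^d)$ is a complex-valued map that preserves those linear combinations that lie in the set. Translations. For $p\in\mathbb{R}^d$, $t_p^*\sigma:=\sigma(\cdot+p)$. Condition (T) on $\rho$: for $\sigma\in CS^{<-d}_{\rm c.c}(\mathbb{R}^d)$,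 all $N$ and all $p\in\mathbb{R}^d$, $$\rho(t_p^*\sigma)=\sum_{|\beta|\le N}\rho(\partial^\beta\sigma)\frac{p^\beta}{\beta!}+(N+1)\sum_{|\beta|=N+1}\frac{p^\beta}{\beta!}\int_0^1(1-t)^N\rho\big(\partial^\beta\sigma(\cdot+tp)\big)\,dt .$$ Translation invariance. A linear form $\lambda$ on $CS^{\notin\mathbb{Z}}_{\rm c.c}(\mathbb{R}^d)$ restricting to $\rho$ on $CS^{\notin\mathbb{Z}}_{\rm c.c}(\mathbb{R}^d)\cap CS^{<-d}_{\rm c.c}(\mathbb{R}^d)$ is extended to translated symbols by $$\lambda(t_p^*\sigma):=\sum_{|\beta|\le N}\lambda(\partial^\beta\sigma)\frac{p^\beta}{\beta!}+(N+1)\sum_{|\beta|=N+1}\frac{p^\beta}{\beta!}\int_0^1(1-t)^N\rho\big(\partial^\beta\sigma(\cdot+tp)\big)\,dt$$ for any $N$ large enough that $\partial^\beta\sigma\in L^1(\mathbb{R}^d)$ when $|\beta|=N+1$ (the result does not depend on such $N$). It is called $\mathbb{R}^d$- (resp. $\mathbb{Z}^d$-) translation invariant if for every $\sigma\in CS^{\notin\mathbb{Z}}_{\rm c.c}(\mathbb{R}^d)$, every large enough $N$ and every $p\in\mathbb{R}^d$ (resp. $p\in\mathbb{Z}^d$), $$\sum_{0<|\beta|\le N}\lambda(\partial^\beta\sigma)\frac{p^\beta}{\beta!}+(N+1)\sum_{|\beta|=N+1}\frac{p^\beta}{\beta!}\int_0^1(1-t)^N\rho\big(\partial^\beta\sigma(\cdot+tp)\big)\,dt=0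 .$$ *)

(* Defs.v *)
From HB Require Import structures.
From mathcomp Require Import all_boot all_order all_algebra complex.
From mathcomp Require Import all_classical all_reals all_analysis.
Set Implicit Arguments.
Unset Strict Implicit.
Unset Printing Implicit Defensive.
Import Order.TTheory GRing.Theory Num.Theory.
Import numFieldNormedType.Exports.
Local Open Scope classical_set_scope.
Local Open Scope ring_scope.
Local Open Scope complex_scope.

(* Lebesgue measure on R^n: the n-fold product of the one-dimensional Lebesgue
   measure, carried by n-tuples with the product sigma-algebra (row vectors have
   no measurable structure in the library). *)

Section lebesgue_tuple.
Context {R : realType}.
Local Notation T := (measurableTypeR R).

Definition tcons n (x : T * n.-tuple T) : n.+1.-tuple T := [tuple of x.1 :: x.2].

Lemma measurable_tcons n : measurable_fun [set: T * n.-tuple T] (@tcons n).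
Proof. exact: measurable_cons. Qed.

Section step.
Variables (n : nat) (m : {sigma_finite_measure set (n.-tuple T) -> \bar R}).

Definition lebesgue_tcons : set (n.+1.-tuple T) -> \bar R :=
  pushforward (@lebesgue_measure R \x m)%E (@tcons n).

Let lebesgue_tcons0 : lebesgue_tcons set0 = 0%E.
Proof. by rewrite /lebesgue_tcons /pushforward preimage_set0 measure0. Qed.

Let lebesgue_tcons_ge0 A : (0 <= lebesgue_tcons A)%E.
Proof. by rewrite /lebesgue_tcons /pushforward; exact: measure_ge0. Qed.

Let lebesgue_tcons_sigma_additive : semi_sigma_additive lebesgue_tcons.
Proof.
have mtcons A : measurable A -> measurable (@tcons n @^-1` A).
  by move=> mA; rewrite -[X in measurable X]setTI; exact: measurable_tcons.
move=> F mF tF mUF; rewrite /lebesgue_tcons /pushforward preimage_bigcup.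
apply: measure_semi_sigma_additive => [k||]; first exact: mtcons.
- apply/trivIsetP => /= i j _ _ ij; rewrite -preimage_setI.
  by move/trivIsetP : tF => /(_ _ _ _ _ ij) ->//; rewrite preimage_set0.
- by rewrite -preimage_bigcup; exact: mtcons.
Qed.

HB.instance Definition _ := isMeasure.Build _ _ _ lebesgue_tcons
  lebesgue_tcons0 lebesgue_tcons_ge0 lebesgue_tcons_sigma_additive.

Let sigma_finite_lebesgue_tcons : sigma_finite setT lebesgue_tcons.
Proof.
pose split (t : n.+1.-tuple T) := (thead t, [tuple of behead t]).
have msplit : measurable_fun [set: n.+1.-tuple T] split.
  by apply/measurable_fun_pair; [exact: measurable_tnth | exact: measurable_behead].
have tconsK : cancel (@tcons n) split.
  by case=> x t; congr pair; apply/val_inj.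
have /sigma_finiteP[F [TF ndF Foo]] := sigma_finiteT (@lebesgue_measure R).
have /sigma_finiteP[G [TG ndG Goo]] := sigma_finiteT m.
exists (fun k => split @^-1` (F k `*` G k)).
  rewrite -preimage_bigcup (_ : \bigcup_k _ = setT) ?preimage_setT//.
  rewrite -setXTT TF TG predeqE => -[x y]; split.
    by move=> [k _ []/= ? ?]; split; exists k.
  move=> [/= [i _ Fx] [j _ Gy]]; exists (maxn i j) => //; split.
  - by move: x Fx; exact/subsetPset/ndF/leq_maxl.
  - by move: y Gy; exact/subsetPset/ndG/leq_maxr.
move=> k; have [? ?] := Foo k; have [? ?] := Goo k; split.
  by rewrite -[X in measurable X]setTI; apply: msplit => //; exact: measurableX.
rewrite /lebesgue_tcons /pushforward -comp_preimage.
rewrite (_ : split \o @tcons n = id); last by apply/funext => x; exact: tconsK.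
by rewrite preimage_id product_measure1E// lte_mul_pinfty// ge0_fin_numE.
Qed.

HB.instance Definition _ := @Measure_isSigmaFinite.Build _ _ _ lebesgue_tcons
  sigma_finite_lebesgue_tcons.

End step.

Fixpoint lebesgue_tuple n : {sigma_finite_measure set (n.-tuple T) -> \bar R} :=
  match n with
  | 0 => \d_([tuple] : 0.-tuple T)
  | k.+1 => lebesgue_tcons (lebesgue_tuple k)
  end.

End lebesgue_tuple.

Section symbols.
Context {R : realType} {d : nat}.
Local Notation C := R[i].
Local Notation Rd := 'rV[R]_d.

(* Complex-valued functions are differentiated and integrated through their
   real and imaginary parts. *)

Definition partial (i : 'I_d) (f : Rd -> C) : Rd -> C := fun x =>
  'D_(delta_mx 0 i) (fun y => complex.Re (f y)) x +i*
  'D_(delta_mx 0 i) (fun y => complex.Im (f y)) x.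

Definition partials (s : seq 'I_d) (f : Rd -> C) : Rd -> C := foldr partial f s.

Definition cdifferentiable (f : Rd -> C) (x : Rd) :=
  differentiable (fun y => complex.Re (f y)) x /\
  differentiable (fun y => complex.Im (f y)) x.

(* C^oo on the open set U: all iterated partial derivatives, of any order, are
   (Frechet-)differentiable at every point of U. *)
Definition smooth_on (U : set Rd) (f : Rd -> C) :=
  forall (s : seq 'I_d) (x : Rd), U x -> cdifferentiable (partials s f) x.

Definition smooth (f : Rd -> C) := smooth_on setT f.

Definition mdegree (b : 'I_d -> nat) : nat := (\sum_i b i)%N.

Definition mfact (b : 'I_d -> nat) : nat := (\prod_i (b i)`!)%N.

Definition mpower (p : Rd) (b : 'I_d -> nat) : R := \prod_i p 0 i ^+ b i.

Definition mpartial (b : 'I_d -> nat) (f : Rd -> C) : Rd -> C :=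
  partials (flatten [seq nseq (b i) i | i <- enum 'I_d]) f.

(* The norm of the library on 'rV[R]_d is the sup norm. *)
Definition enorm (x : Rd) : R := Num.sqrt (\sum_i x 0 i ^+ 2).

(* t ^ a for t > 0 and a complex exponent a *)
Definition cpow (t : R) (a : C) : C :=
  (t `^ complex.Re a)%:C *
  (cos (complex.Im a * ln t) +i* sin (complex.Im a * ln t)).

Definition symbol (a : C) : set (Rd -> C) := [set s |
  smooth s /\
  forall b : 'I_d -> nat, exists K : R, forall x,
    `|mpartial b s x| <=
    (K * (1 + enorm x) `^ (complex.Re a - (mdegree b)%:R))%:C].

Definition pos_homogeneous (a : C) (f : Rd -> C) :=
  forall (t : R) (x : Rd), 0 < t -> x != 0 -> f (t *: x) = cpow t a * f x.

Definition cutoff (chi : Rd -> R) :=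
  [/\ smooth (fun x => (chi x)%:C),
      \forall x \near (0 : Rd), chi x = 0 &
      forall x, 1 <= enorm x -> chi x = 1].

(* The homogeneous components f j, of degree a - j, do not depend on N.  The
   inclusion in symbol a is the case N = 0. *)
Definition classical_symbol (a : C) : set (Rd -> C) := [set s |
  exists (chi : Rd -> R) (f : nat -> Rd -> C),
  [/\ cutoff chi,
      forall j, smooth_on [set x | x != 0] (f j) /\
                pos_homogeneous (a - j%:R) (f j) &
      forall N, symbol (a - N%:R)
        (fun x => s x - \sum_(j < N) (chi x)%:C * f j x)]].

Definition CS_lt_mdim : set (Rd -> C) := [set s |
  exists2 a : C, complex.Re a < - d%:R & classical_symbol a s].

Definition CS_nonint : set (Rd -> C) := [set s |
  exists2 a : C, ~ (exists k : int, a = k%:~R) & classical_symbol a s].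

Definition row_of_tuple (t : d.-tuple (measurableTypeR R)) : Rd :=
  \row_i tnth t i.

Definition cintegrable d' (T : measurableType d')
    (mu : {measure set T -> \bar R}) (D : set T) (f : T -> C) :=
  mu.-integrable D (fun x => (complex.Re (f x))%:E) /\
  mu.-integrable D (fun x => (complex.Im (f x))%:E).

Definition cintegral d' (T : measurableType d')
    (mu : {measure set T -> \bar R}) (D : set T) (f : T -> C) : C :=
  (\int[mu]_(x in D) complex.Re (f x)) +i*
  (\int[mu]_(x in D) complex.Im (f x)).

Definition L1 : set (Rd -> C) := [set f |
  cintegrable (@lebesgue_tuple R d) setT (fun t => f (row_of_tuple t))].

(* A linear form on a set A of functions which need not be a vector space: it
   preserves the linear combinations that lie in A.  Its values off A are
   irrelevant. *)
Definition linear_form_on (A : set (Rd -> C)) (l : (Rd -> C) -> C) :=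
  forall (n : nat) (c : 'I_n -> C) (f : 'I_n -> Rd -> C),
    (forall k, A (f k)) -> A (fun x => \sum_k c k * f k x) ->
    l (fun x => \sum_k c k * f k x) = \sum_k c k * l (f k).

(* Elements of L^1 are almost-everywhere classes, hence the second clause. *)
Definition linear_form_L1 (rho : (Rd -> C) -> C) :=
  linear_form_on L1 rho /\
  forall f g, L1 f -> L1 g ->
    {ae @lebesgue_tuple R d, forall t, f (row_of_tuple t) = g (row_of_tuple t)} ->
    rho f = rho g.

Definition translate (p : Rd) (s : Rd -> C) : Rd -> C := fun x => s (x + p).

Definition taylor_coef (p : Rd) (b : 'I_d -> nat) : C :=
  (mpower p b / (mfact b)%:R)%:C.

(* A multiindex of degree < n takes values < n, so finite sums over such
   multiindices range over finite functions into 'I_n. *)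
Definition mindex n (b : {ffun 'I_d -> 'I_n}) : 'I_d -> nat := fun i => b i.

Definition taylor_sum (l : (Rd -> C) -> C) (P : pred nat) (N : nat) (p : Rd)
    (s : Rd -> C) : C :=
  \sum_(b : {ffun 'I_d -> 'I_N.+1} |
         P (mdegree (mindex b)) && (mdegree (mindex b) <= N)%N)
    l (mpartial (mindex b) s) * taylor_coef p (mindex b).

Definition remainder_integrand (rho : (Rd -> C) -> C) (N : nat) (p : Rd)
    (s : Rd -> C) (b : 'I_d -> nat) (t : R) : C :=
  ((1 - t) ^+ N)%:C * rho (translate (t *: p) (mpartial b s)).

Definition taylor_remainder (rho : (Rd -> C) -> C) (N : nat) (p : Rd)
    (s : Rd -> C) : C :=
  N.+1%:R * \sum_(b : {ffun 'I_d -> 'I_N.+2} | mdegree (mindex b) == N.+1)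
    taylor_coef p (mindex b) *
    cintegral (@lebesgue_measure R) `[0, 1]
      (remainder_integrand rho N p s (mindex b)).

(* The existence of the integrals is part of the condition, since
   cintegral is total. *)
Definition taylor_compatible (rho : (Rd -> C) -> C) :=
  forall (s : Rd -> C) (N : nat) (p : Rd), CS_lt_mdim s ->
    (forall b : 'I_d -> nat, mdegree b = N.+1 ->
      cintegrable (@lebesgue_measure R) `[0, 1]
        (remainder_integrand rho N p s b)) /\
    rho (translate p s) = taylor_sum rho predT N p s + taylor_remainder rho N p s.

(* Invariance under the translations by p in G.  When rho is Taylor compatible,
   the case N = 0 of that condition yields the existence of the integrals here. *)
Definition translation_invariant (G : set Rd) (rho l : (Rd -> C) -> C) :=
  forall (s : Rd -> C) (N : nat) (p : Rd), CS_nonint s ->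
    (forall b : 'I_d -> nat, mdegree b = N.+1 -> L1 (mpartial b s)) -> G p ->
    taylor_sum l (fun n => (0 < n)%N) N p s + taylor_remainder rho N p s = 0.

Definition integer_lattice : set Rd := [set p | forall i, p 0 i \is a Num.int].

End symbols.

(* Main.v *)
From HB Require Import structures.
Require Import Defs.
From mathcomp Require Import all_boot all_order all_algebra complex.
From mathcomp Require Import all_classical all_reals all_analysis.
From mathcomp Require Import measurable_realfun ring lra.
Set Implicit Arguments.
Unset Strict Implicit.
Unset Printing Implicit Defensive.
Import Order.TTheory GRing.Theory Num.Theory.
Import numFieldNormedType.Exports.
Local Open Scope classical_set_scope.
Local Open Scope ring_scope.
Local Open Scope complex_scope.

(** Let lambda1 and lambda2 be two invariant extensions of rho.  They agree on
    symbols of order less than -d, and the remainders of their Taylor formulas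
    are literally the same number, since those involve rho only.

    Invariance kills derivatives.  Subtracting the two invariance identities
    for p = k e_i, with k a natural number, leaves a polynomial in k without
    remainder that vanishes for all k.  So its coefficient of degree 1, which is
    lambda1 - lambda2 evaluated at the i-th partial derivative of the symbol, is
    zero (partial_of_invariance).  The identities are available because the
    derivatives of high order of a symbol decay fast enough to be integrable
    (L1_mpartial), by comparison with the product of the functions
    1 / (1 + x_i^2).

    Derivatives are everything up to order less than -d.  If h is homogeneous
    of degree a, Euler's identity reads
    sum_i d_i (x_i h) = (a + d) h away from 0 (euler_divergence), and a + d is
    not 0 when a is not an integer.  With a cut-off function chi,
    sum_i d_i (chi x_i h) - (a + d) chi h
    is smooth and vanishes outside the unit ball, so it is a classical symbol of
    every order and the two forms agree on it; hence they agree on chi h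
    (invariant_eq_cutoffM).  A classical symbol is a finite sum of such terms
    chi h plus a classical symbol of order less than -d (invariant_eq).

    Except for the remainders of an expansion, each membership in a symbol class
    comes from one lemma: a smooth function that coincides outside the unit ball
    with a function homogeneous of degree a is a classical symbol of order a
    (homogeneous_tail_classical).  It makes estimates for products and commuting
    partial derivatives superfluous. *)

(** * Smooth complex-valued functions *)

(** Differentiability is local: the differential of f serves for g, because the
    error term of g is the one of f near x. *)
Lemma near_eq_differentiable (K : numFieldType) (V W : normedModType K)
    (f g : V -> W) (x : V) :
  {near x, f =1 g} -> differentiable f x -> differentiable g x.
Proof.
move=> fg df.
suff E : g \o shift x = cst (g x) + 'd f x +o_ 0 id.
  have dE := diff_unique (diff_continuous df) E.
  by apply/diff_locallyP; rewrite dE; split=> //; exact: diff_continuous.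
have := diff_locally df.
move=> /eqaddoP Ho.
apply/eqaddoP => e e0.
have := Ho _ e0.
have fgx : f x = g x by exact: nbhs_singleton fg.
have fg0 : \forall y \near 0, f (y + x) = g (y + x).
  by move: fg; rewrite (near_shift 0) /= subr0.
apply: filter_app.
near=> y.
suff -> : (g \o shift x - (cst (g x) + 'd f x)) y
      = (f \o shift x - (cst (f x) + 'd f x)) y by [].
rewrite /= [LHS]/GRing.add /GRing.opp [RHS]/GRing.add /GRing.opp /=.
rewrite [in RHS]/GRing.add [in LHS]/GRing.add/= /cst fgx.
by congr (_ + _); apply/esym; near: y.
Unshelve. all: by end_near. Qed.

Section complex_differentiation.
Context {R : realType} {d : nat}.
Local Notation C := R[i].
Local Notation Rd := 'rV[R]_d.
Implicit Types (f g : Rd -> C) (U : set Rd) (i : 'I_d) (s : seq 'I_d).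

Lemma near_eq_cdifferentiable f g (x : Rd) :
  {near x, f =1 g} -> cdifferentiable f x -> cdifferentiable g x.
Proof.
move=> fg [fr fi]; split.
- by apply: near_eq_differentiable fr; apply: filterS fg => y /= ->.
- by apply: near_eq_differentiable fi; apply: filterS fg => y /= ->.
Qed.

Lemma near_eq_partial i f g (x : Rd) :
  {near x, f =1 g} -> partial i f x = partial i g x.
Proof.
move=> fg; rewrite /partial; congr (_ +i* _).
- by apply: near_eq_derive; apply: filterS fg => y /= ->.
- by apply: near_eq_derive; apply: filterS fg => y /= ->.
Qed.

Lemma eq_on_partials U s f g : open U -> {in U, f =1 g} ->
  {in U, partials s f =1 partials s g}.
Proof.
move=> oU fg; elim: s => [//|i s IH] x xU /=.
apply: near_eq_partial.
have : nbhs x U by apply: open_nbhs_nbhs; split=> //; rewrite inE in xU.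
by apply: filterS => y yU; apply: IH; rewrite inE.
Qed.

Lemma cdifferentiable_cst (c : C) (x : Rd) : cdifferentiable (fun=> c) x.
Proof. by split; exact: differentiable_cst. Qed.

Lemma partial_cst i (c : C) : partial i (fun=> c) = fun=> 0.
Proof.
by apply/funext => x; rewrite /partial !(derive_cst _ x).
Qed.

Lemma ReM (a b : C) : complex.Re (a * b) =
  complex.Re a * complex.Re b - complex.Im a * complex.Im b.
Proof. by case: a; case: b. Qed.

Lemma ImM (a b : C) : complex.Im (a * b) =
  complex.Re a * complex.Im b + complex.Im a * complex.Re b.
Proof. by case: a; case: b. Qed.

Lemma ReD (a b : C) : complex.Re (a + b) = complex.Re a + complex.Re b.
Proof. by case: a; case: b. Qed.

Lemma ImD (a b : C) : complex.Im (a + b) = complex.Im a + complex.Im b.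
Proof. by case: a; case: b. Qed.

Lemma cdifferentiableD f g (x : Rd) : cdifferentiable f x ->
  cdifferentiable g x -> cdifferentiable (fun y => f y + g y) x.
Proof.
move=> [fr fi] [gr gi]; split; under eq_fun do rewrite (ReD, ImD);
  exact: differentiableD.
Qed.

Lemma partialD i f g (x : Rd) : cdifferentiable f x ->
  cdifferentiable g x ->
  partial i (fun y => f y + g y) x = partial i f x + partial i g x.
Proof.
move=> [fr fi] [gr gi]; rewrite /partial.
under eq_fun do rewrite ReD.
under [X in _ +i* 'D_ _ X _]eq_fun do rewrite ImD.
rewrite -[LHS]/(_ +i* _) deriveD; [|exact: diff_derivable..].
by rewrite deriveD; [|exact: diff_derivable..].
Qed.

Lemma cdifferentiableM f g (x : Rd) : cdifferentiable f x ->
  cdifferentiable g x -> cdifferentiable (fun y => f y * g y) x.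
Proof.
move=> [fr fi] [gr gi]; split; under eq_fun do rewrite (ReM, ImM).
- by apply: differentiableB; exact: differentiableM.
- by apply: differentiableD; exact: differentiableM.
Qed.

Lemma partialM i f g (x : Rd) : cdifferentiable f x ->
  cdifferentiable g x ->
  partial i (fun y => f y * g y) x = partial i f x * g x + f x * partial i g x.
Proof.
move=> [fr fi] [gr gi]; set e : Rd := delta_mx 0 i.
have dfr := @diff_derivable _ _ _ _ _ e fr.
have dfi := @diff_derivable _ _ _ _ _ e fi.
have dgr := @diff_derivable _ _ _ _ _ e gr.
have dgi := @diff_derivable _ _ _ _ _ e gi.
have DM (u v : Rd -> R) : derivable u x e -> derivable v x e ->
    'D_e (fun y => u y * v y) x = u x * 'D_e v x + v x * 'D_e u x.
  by move=> du dv; exact: (deriveM du dv).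
have DMB (u v w z : Rd -> R) : derivable u x e -> derivable v x e ->
    derivable w x e -> derivable z x e ->
    'D_e (fun y => u y * v y - w y * z y) x =
    (u x * 'D_e v x + v x * 'D_e u x) - (w x * 'D_e z x + z x * 'D_e w x).
  move=> du dv dw dz; rewrite -!DM//.
  exact: (deriveB (@derivableM _ _ _ _ _ _ du dv)
    (@derivableM _ _ _ _ _ _ dw dz)).
have DMD (u v w z : Rd -> R) : derivable u x e -> derivable v x e ->
    derivable w x e -> derivable z x e ->
    'D_e (fun y => u y * v y + w y * z y) x =
    (u x * 'D_e v x + v x * 'D_e u x) + (w x * 'D_e z x + z x * 'D_e w x).
  move=> du dv dw dz; rewrite -!DM//.
  exact: (deriveD (@derivableM _ _ _ _ _ _ du dv)
    (@derivableM _ _ _ _ _ _ dw dz)).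
rewrite /partial -/e.
under eq_fun do rewrite ReM.
under [X in _ +i* 'D_ _ X _]eq_fun do rewrite ImM.
rewrite DMB// DMD//.
case: (f x) (g x) => [a b] [a' b'] /=.
by congr (_ +i* _); ring.
Qed.

Lemma cdifferentiable_coord i (x : Rd) :
  cdifferentiable (fun y => (y 0 i)%:C) x.
Proof.
split=> /=; last exact: differentiable_cst.
exact: differentiable_coord.
Qed.

Lemma partial_coord i j :
  partial i (fun y : Rd => (y 0 j)%:C) = fun=> (i == j)%:R.
Proof.
apply/funext => x; rewrite /partial /= (derive_cst _ x).
have dc := @differentiable_coord _ _ _ x 0 j.
rewrite deriveE //.
have @f : {linear Rd -> R}.
  by exists (fun N : Rd => N 0 j); do 2![eexists]; do ?[constructor];
     rewrite ?mxE// => ? *; rewrite ?mxE//; move=> ?; rewrite !mxE.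
rewrite (_ : (fun _ => _) = f) //.
rewrite (@diff_lin _ _ _ f x) //=.
  by rewrite mxE eqxx/= eq_sym; case: eqP.
exact: coord_continuous.
Qed.

(** The class C^(n+1), by recursion on n: closure of smooth_on under products
    does not follow by induction along one list of indices, since the Leibniz
    rule splits that list between the two factors. *)
Fixpoint smooth_upto U n f : Prop :=
  (forall x, U x -> cdifferentiable f x) /\
  (if n is n'.+1 then forall i, smooth_upto U n' (partial i f) else True).

Lemma smooth_uptoP U f : smooth_on U f <-> forall n, smooth_upto U n f.
Proof.
split=> [sf n|sf].
  elim: n f sf => [|n IH] f sf; split=> //; try exact: (sf [::]).
  move=> i; apply: IH => s x Ux.
  by have := sf (rcons s i) x Ux; rewrite /partials foldr_rcons.
move=> s; have := sf (size s) => {sf}.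
elim/last_ind: s f => [|s i IH] f; first by case.
rewrite size_rcons => -[_ sf] x Ux.
by rewrite /partials foldr_rcons; exact: (IH _ (sf i)).
Qed.

Lemma smooth_uptoW U n f : smooth_upto U n.+1 f -> smooth_upto U n f.
Proof.
by elim: n f => [|n IH] f [cf df]; split=> // i; apply: IH; exact: df.
Qed.

Lemma eq_on_smooth_upto U n f g : open U -> {in U, f =1 g} ->
  smooth_upto U n f -> smooth_upto U n g.
Proof.
move=> oU; elim: n f g => [|n IH] f g fg [cf df].
  split=> // x Ux; apply: near_eq_cdifferentiable (cf x Ux).
  have : nbhs x U by apply: open_nbhs_nbhs.
  by apply: filterS => y yU; apply: fg; rewrite inE.
split.
  move=> x Ux; apply: near_eq_cdifferentiable (cf x Ux).
  have : nbhs x U by apply: open_nbhs_nbhs.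
  by apply: filterS => y yU; apply: fg; rewrite inE.
by move=> i; apply: IH (df i); exact: (@eq_on_partials U [:: i]).
Qed.

Lemma eq_on_smooth U f g : open U -> {in U, f =1 g} ->
  smooth_on U f -> smooth_on U g.
Proof.
move=> oU fg /smooth_uptoP sf; apply/smooth_uptoP => n.
exact: eq_on_smooth_upto fg (sf n).
Qed.

Lemma smooth_on_cdiff U f : smooth_on U f ->
  forall x, U x -> cdifferentiable f x.
Proof. by move=> sf; exact: (sf [::]). Qed.

Lemma smooth_on_partial U i f : smooth_on U f -> smooth_on U (partial i f).
Proof.
by move=> sf s x Ux; have := sf (rcons s i) x Ux; rewrite /partials foldr_rcons.
Qed.

Lemma smooth_on_partials U s f : smooth_on U f -> smooth_on U (partials s f).
Proof. by move=> sf; elim: s => //= i s IH; exact: smooth_on_partial. Qed.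

Lemma smooth_uptoD U n f g : open U -> smooth_upto U n f ->
  smooth_upto U n g -> smooth_upto U n (fun x => f x + g x).
Proof.
move=> oU; elim: n f g => [|n IH] f g [cf df] [cg dg].
  by split=> // x Ux; apply: cdifferentiableD; [exact: cf|exact: cg].
split=> [x Ux|i]; first by apply: cdifferentiableD; [exact: cf|exact: cg].
apply: (@eq_on_smooth_upto _ _ (fun x => partial i f x + partial i g x)) => //.
  by move=> x /set_mem Ux; rewrite partialD; [|exact: cf|exact: cg].
by apply: IH; [exact: df|exact: dg].
Qed.

Lemma smooth_uptoM U n f g : open U -> smooth_upto U n f ->
  smooth_upto U n g -> smooth_upto U n (fun x => f x * g x).
Proof.
move=> oU; elim: n f g => [|n IH] f g sf sg; have [cf df] := sf;
  have [cg dg] := sg.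
  by split=> // x Ux; apply: cdifferentiableM; [exact: cf|exact: cg].
split=> [x Ux|i]; first by apply: cdifferentiableM; [exact: cf|exact: cg].
apply: (@eq_on_smooth_upto _ _
  (fun x => partial i f x * g x + f x * partial i g x)) => //.
  by move=> x /set_mem Ux; rewrite partialM; [|exact: cf|exact: cg].
apply: smooth_uptoD => //; apply: IH;
  [exact: df|exact: smooth_uptoW| |exact: dg].
exact: smooth_uptoW.
Qed.

Lemma smooth_onD U f g : open U -> smooth_on U f -> smooth_on U g ->
  smooth_on U (fun x => f x + g x).
Proof.
move=> oU /smooth_uptoP sf /smooth_uptoP sg; apply/smooth_uptoP => n.
exact: smooth_uptoD.
Qed.

Lemma smooth_onM U f g : open U -> smooth_on U f -> smooth_on U g ->
  smooth_on U (fun x => f x * g x).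
Proof.
move=> oU /smooth_uptoP sf /smooth_uptoP sg; apply/smooth_uptoP => n.
exact: smooth_uptoM.
Qed.

Lemma smooth_on_cst U (c : C) : smooth_on U (fun=> c).
Proof.
apply/smooth_uptoP => n; elim: n c => [|n IH] c; split=> //;
  try by move=> x _; exact: cdifferentiable_cst.
by move=> i; rewrite partial_cst.
Qed.

Lemma smooth_on_coord U i : smooth_on U (fun x => (x 0 i)%:C).
Proof.
apply/smooth_uptoP => n; case: n => [|n]; split=> //;
  try by move=> x _; exact: cdifferentiable_coord.
move=> j; rewrite partial_coord; move: n; apply/smooth_uptoP.
exact: smooth_on_cst.
Qed.

Lemma smooth_on_sum U (n : nat) (F : 'I_n -> Rd -> C) : open U ->
  (forall k, smooth_on U (F k)) -> smooth_on U (fun x => \sum_k F k x).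
Proof.
move=> oU; elim: n F => [|n IH] F sF.
  under eq_fun do rewrite big_ord0.
  exact: smooth_on_cst.
under eq_fun do rewrite big_ord_recl.
by apply: smooth_onD => //; apply: IH.
Qed.

Lemma smooth_onW U (V : set Rd) f : U `<=` V -> smooth_on V f -> smooth_on U f.
Proof. by move=> UV sf s x /UV; exact: sf. Qed.

(** Smoothness is local, and two open sets suffice below: the complement of the
    origin and a neighbourhood of the origin. *)
Lemma smooth_cover U V f : U `|` V = setT -> smooth_on U f -> smooth_on V f ->
  smooth f.
Proof.
move=> UV fU fV s x _; have : (U `|` V) x by rewrite UV.
by case; [exact: fU|exact: fV].
Qed.

End complex_differentiation.

(** * Homogeneous functions and Euler's identity *)

Section homogeneous.
Context {R : realType} {d : nat}.
Local Notation C := R[i].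
Local Notation Rd := 'rV[R]_d.
Implicit Types (f g : Rd -> C) (i : 'I_d) (a : C).

Lemma cpowB1 (t : R) a : 0 < t -> cpow t (a - 1) = t^-1%:C * cpow t a.
Proof.
move=> t0; case: a => a b; rewrite /cpow /= subr0 powRB; last first.
  by rewrite (gt_eqF t0) implybT.
rewrite powRr1 ?ltW// mulrA; congr (_ * _).
by rewrite mulrC -rmorphM.
Qed.

Lemma cpowD1 (t : R) a : 0 < t -> cpow t (a + 1) = t%:C * cpow t a.
Proof.
move=> t0; rewrite -[in RHS](addrK 1 a) cpowB1// mulrA -rmorphM/=.
rewrite divff ?gt_eqF//.
by rewrite mul1r.
Qed.

Lemma norm_cpow (t : R) a : `|cpow t a| = (t `^ complex.Re a)%:C.
Proof.
rewrite /cpow normrM !normc_def /= expr0n/= addr0 sqrtr_sqr.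
rewrite ger0_norm ?powR_ge0//.
by rewrite cos2Dsin2 sqrtr1 mulr1.
Qed.

Lemma open_neq0 : open [set x : Rd | x != 0].
Proof.
rewrite (_ : [set x : Rd | x != 0] = ~` [set 0]).
  apply/closed_openC/accessible_closed_set1/hausdorff_accessible.
  exact: norm_hausdorff.
by apply/seteqP; split => x /=; move/eqP.
Qed.

Lemma partial_dilation i (t : R) f (x : Rd) : cdifferentiable f (t *: x) ->
  partial i (fun y => f (t *: y)) x = t%:C * partial i f (t *: x).
Proof.
move=> [fr fi]; set e : Rd := delta_mx 0 i.
have ds := ex_diff (is_diff_def := is_diff_scaler t x).
have D (u : Rd -> R) : differentiable u (t *: x) ->
    'D_e (fun y => u (t *: y)) x = t * 'D_e u (t *: x).
  move=> du; have dc := differentiable_comp ds du.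
  transitivity ('d (u \o *:%R t) x e); first exact: (deriveE e dc).
  transitivity ('d u (t *: x) ('d ( *:%R t) x e)).
    exact: (congr1 (fun h : Rd -> R => h e) (diff_comp ds du)).
  rewrite (diff_val (is_diff_def := is_diff_scaler t x)) linearZ.
  by congr (_ * _); exact/esym/(deriveE e du).
rewrite /partial -/e (D _ fr) (D _ fi).
by apply/eqP; rewrite eq_complex /= !mul0r subr0 addr0 !eqxx.
Qed.

Lemma pos_homogeneous_coord i a f : pos_homogeneous a f ->
  pos_homogeneous (a + 1) (fun x => (x 0 i)%:C * f x).
Proof.
move=> hf t x t0 x0; rewrite hf// cpowD1// mxE rmorphM/=.
by rewrite mulrACA.
Qed.

(** Differentiating f (t x) = t^a f x with respect to x_i produces a factor t on
    the left-hand side, hence the drop of the degree by 1. *)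
Lemma pos_homogeneous_partial i a f : smooth_on [set x | x != 0] f ->
  pos_homogeneous a f -> pos_homogeneous (a - 1) (partial i f).
Proof.
move=> sf hf t x t0 x0.
have tx0 : t *: x != 0 by rewrite scaler_eq0 negb_or gt_eqF.
have nx : nbhs x [set x : Rd | x != 0].
  by apply: open_nbhs_nbhs; split=> //; exact: open_neq0.
have E : partial i (fun y => f (t *: y)) x
       = partial i (fun y => cpow t a * f y) x.
  by apply: near_eq_partial; apply: filterS nx => y y0; exact: hf.
move: E; rewrite partial_dilation; last exact: smooth_on_cdiff sf _ tx0.
rewrite partialM; [|exact: cdifferentiable_cst|exact: smooth_on_cdiff sf _ x0].
rewrite partial_cst mul0r add0r cpowB1// -mulrA => <-.
by rewrite mulrA -rmorphM/= mulVf ?gt_eqF// mul1r.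
Qed.

Lemma pos_homogeneous_partials (s : seq 'I_d) a f :
  smooth_on [set x | x != 0] f ->
  pos_homogeneous a f -> pos_homogeneous (a - (size s)%:R) (partials s f).
Proof.
move=> sf hf; elim: s => [|i s IH] /=; first by rewrite subr0.
rewrite -addn1 natrD opprD addrA; apply: pos_homogeneous_partial => //.
exact: smooth_on_partials.
Qed.

Lemma is_derive_ray (u : Rd -> R) (x : Rd) : differentiable u x ->
  is_derive (1 : R) 1 (fun t => u (t *: x))
    (\sum_i x 0 i * 'D_(delta_mx 0 i) u x).
Proof.
move=> du; have du1 : differentiable u (1 *: x) by rewrite scale1r.
have ds : is_diff (1 : R) (fun t : R => t *: x) ( *:%R ^~ x).
  exact: is_diff_scalel.
have dc := differentiable_comp (ex_diff (is_diff_def := ds)) du1.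
apply: DeriveDef; first exact: diff_derivable dc.
rewrite (deriveE _ dc) (diff_comp (ex_diff (is_diff_def := ds)) du1) /=.
rewrite (diff_val (is_diff_def := ds)) !scale1r.
rewrite [X in 'd u x X](row_sum_delta x) linear_sum; apply: eq_bigr => i _.
by rewrite linearZ/= deriveE.
Qed.

(** Both sides are the derivative at t = 1 of f (t x) = t^a f x: the chain rule
    gives the left-hand side, the derivative of t^a the right-hand side.  The
    computation is done on real and imaginary parts. *)
Lemma euler_identity a f (x : Rd) : smooth_on [set x | x != 0] f ->
  pos_homogeneous a f -> x != 0 ->
  \sum_i (x 0 i)%:C * partial i f x = a * f x.
Proof.
move=> sf hf x0; have [dr di] := smooth_on_cdiff sf x0.
have near1 : \forall t \near (1 : R), 0 < t by exact: lt_nbhsr.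
case: a hf => a b hf.
have dl : is_derive (1 : R) 1 (fun t => b * ln t) b.
  have := is_derive1_ln (@ltr01 R) => dln.
  by apply: is_derive_eq; rewrite invr1 /GRing.scale /= mulr1.
have dc : is_derive (1 : R) 1 (fun t => cos (b * ln t)) 0.
  have := @is_derive1_comp _ cos (fun t => b * ln t) 1 _ _ (is_derive_cos _) dl.
  by rewrite /= ln1 mulr0 sin0 oppr0 mul0r.
have ds : is_derive (1 : R) 1 (fun t => sin (b * ln t)) b.
  have := @is_derive1_comp _ sin (fun t => b * ln t) 1 _ _ (is_derive_sin _) dl.
  by rewrite /= ln1 mulr0 cos0 mul1r.
have dp : is_derive (1 : R) 1 (fun t : R => t `^ a) a.
  by have := is_derive1_powR a (@ltr01 R); rewrite powR1 mulr1.
have eqR : \sum_i x 0 i * 'D_(delta_mx 0 i) (fun y => complex.Re (f y)) x =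
    a * complex.Re (f x) - b * complex.Im (f x).
  have [_ <-] := is_derive_ray dr.
  have E : \forall t \near (1 : R), complex.Re (f (t *: x)) =
      t `^ a * (cos (b * ln t)) * complex.Re (f x)
      - t `^ a * (sin (b * ln t)) * complex.Im (f x).
    apply: filterS near1 => t t0; rewrite hf// /cpow.
    by case: (f x) => u v /=; ring.
  rewrite (near_eq_derive _ E).
  apply: derive_val; apply: is_derive_eq.
  by rewrite /= powR1 ln1 mulr0 cos0 sin0 /GRing.scale/=; ring.
have eqI : \sum_i x 0 i * 'D_(delta_mx 0 i) (fun y => complex.Im (f y)) x =
    a * complex.Im (f x) + b * complex.Re (f x).
  have [_ <-] := is_derive_ray di.
  have E : \forall t \near (1 : R), complex.Im (f (t *: x)) =
      t `^ a * (cos (b * ln t)) * complex.Im (f x)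
      + t `^ a * (sin (b * ln t)) * complex.Re (f x).
    apply: filterS near1 => t t0; rewrite hf// /cpow.
    by case: (f x) => u v /=; ring.
  rewrite (near_eq_derive _ E).
  apply: derive_val; apply: is_derive_eq.
  by rewrite /= powR1 ln1 mulr0 cos0 sin0 /GRing.scale/=; ring.
have -> : \sum_i (x 0 i)%:C * partial i f x =
    (\sum_i x 0 i * 'D_(delta_mx 0 i) (fun y => complex.Re (f y)) x) +i*
    (\sum_i x 0 i * 'D_(delta_mx 0 i) (fun y => complex.Im (f y)) x).
  elim/big_ind3 : _ => [//|u1 u2 v1 v2 w1 w2 -> -> //|i _].
  by apply/eqP; rewrite eq_complex /= !mul0r subr0 addr0 !eqxx.
rewrite eqR eqI; case: (f x) => u v.
by apply/eqP; rewrite eq_complex /= [_ * v + _]addrC !eqxx.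
Qed.

(** The form of Euler's identity that exhibits a multiple of f as a sum of
    derivatives. *)
Lemma euler_divergence a f (x : Rd) : smooth_on [set x | x != 0] f ->
  pos_homogeneous a f -> x != 0 ->
  \sum_i partial i (fun y => (y 0 i)%:C * f y) x = (a + d%:R) * f x.
Proof.
move=> sf hf x0.
under eq_bigr => i _.
  rewrite partialM; [|exact: cdifferentiable_coord|exact: smooth_on_cdiff sf _ x0].
  rewrite partial_coord eqxx mul1r; over.
rewrite big_split /= (euler_identity sf hf x0) sumr_const card_ord.
rewrite -[f x *+ d]mulr_natl.
by rewrite -mulrDl addrC.
Qed.

End homogeneous.

(** * Integrability of rapidly decaying functions *)

Section integrability.
Context {R : realType}.
Local Notation C := R[i].
Local Notation T := (measurableTypeR R).

Lemma oneDsqrV_ge0 (x : R) : 0 <= (oneDsqr x)^-1.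
Proof. by rewrite invr_ge0 ltW// oneDsqr_gt0. Qed.

(** An integrable comparison function on R^n that is a product of functions of
    one variable, so that Tonelli's theorem computes its integral. *)
Definition prod_oneDsqrV n (t : n.-tuple T) : R :=
  \prod_(i < n) (oneDsqr (tnth t i))^-1.

Lemma prod_oneDsqrV_ge0 n (t : n.-tuple T) : 0 <= prod_oneDsqrV t.
Proof. by apply: prodr_ge0 => i _; exact: oneDsqrV_ge0. Qed.

Lemma measurable_prod_oneDsqrV n : measurable_fun setT (@prod_oneDsqrV n).
Proof.
apply: measurable_prod => i _.
apply: (@measurableT_comp _ _ _ _ _ _ (fun x : R => (oneDsqr x)^-1)
  _ (fun t : n.-tuple T => tnth t i)); last exact: measurable_tnth.
by apply: continuous_measurable_fun; exact: continuous_oneDsqrV.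
Qed.

Lemma measurable_eprod_oneDsqrV n :
  measurable_fun setT (fun t : n.-tuple T => (prod_oneDsqrV t)%:E).
Proof. by apply/measurable_EFinP; exact: measurable_prod_oneDsqrV. Qed.

Lemma integral_oneDsqrV :
  (\int[@lebesgue_measure R]_x ((oneDsqr x)^-1)%:E = pi%:E)%E.
Proof.
rewrite (@ge0_symfun_integralT R (fun x => (oneDsqr x)^-1)).
- rewrite -set_itvcy integral0y_oneDsqr -EFinM; congr (_%:E).
  by rewrite mulrC divfK.
- by move=> x; exact: oneDsqrV_ge0.
- exact: continuous_oneDsqrV.
- by move=> x /=; rewrite /oneDsqr sqrrN.
Qed.

Lemma integral_prod_oneDsqrV n :
  (\int[@lebesgue_tuple R n]_t (prod_oneDsqrV t)%:E = (pi ^+ n)%:E)%E.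
Proof.
elim: n => [|n IH].
  rewrite /= integral_dirac//; last exact: measurable_eprod_oneDsqrV.
  by rewrite diracT mul1e /prod_oneDsqrV big_ord0 expr0.
transitivity (\int[pushforward (@lebesgue_measure R \x lebesgue_tuple n)
   (@tcons R n)]_t (prod_oneDsqrV t)%:E)%E; first by [].
rewrite ge0_integral_pushforward//; last 3 first.
- exact: measurable_tcons.
- exact: measurable_eprod_oneDsqrV.
- by move=> t _; rewrite lee_fin prod_oneDsqrV_ge0.
rewrite preimage_setT fubini_tonelli1; last 2 first.
- apply/measurable_EFinP.
  apply: measurableT_comp; first exact: measurable_prod_oneDsqrV.
  exact: measurable_tcons.
- by move=> x; rewrite lee_fin prod_oneDsqrV_ge0.
rewrite /fubini_F /=.
have E (x : R) (t : n.-tuple T) :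
    prod_oneDsqrV (tcons (x, t)) = (oneDsqr x)^-1 * prod_oneDsqrV t.
  rewrite /prod_oneDsqrV big_ord_recl; congr (_ * _).
  by apply: eq_bigr => i _; rewrite tnthS.
under eq_integral => x _.
  under eq_integral => t _ do rewrite E EFinM.
  rewrite ge0_integralZl//; last 2 first.
  - exact: measurable_eprod_oneDsqrV.
  - by move=> t _; rewrite lee_fin prod_oneDsqrV_ge0.
  rewrite IH; over.
rewrite ge0_integralZr//.
- by rewrite integral_oneDsqrV -EFinM exprS.
- apply/measurable_EFinP; apply: continuous_measurable_fun.
  exact: continuous_oneDsqrV.
- by rewrite lee_fin exprn_ge0// pi_ge0.
Qed.

Lemma integrable_prod_oneDsqrV n :
  (@lebesgue_tuple R n).-integrable setT (fun t => (prod_oneDsqrV t)%:E).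
Proof.
apply/integrableP; split; first exact: measurable_eprod_oneDsqrV.
under eq_integral => t _ do rewrite gee0_abs ?lee_fin ?prod_oneDsqrV_ge0//.
by rewrite integral_prod_oneDsqrV ltry.
Qed.

Context {d : nat}.
Local Notation Rd := 'rV[R]_d.

(** An open set of R^d is the union of the rational boxes that it contains, and
    there are countably many of them; this relates the topology of row vectors
    to the product sigma-algebra on tuples. *)
Lemma measurable_row_of_tuple (U : set Rd) : open U ->
  measurable (@row_of_tuple R d @^-1` U).
Proof.
move=> oU.
pose box (q : 'rV[rat]_d * rat) : set Rd :=
  [set x | forall i, `|ratr (q.1 0 i) - x 0 i| < ratr q.2].
have mbox q : measurable (@row_of_tuple R d @^-1` box q).
  have -> : @row_of_tuple R d @^-1` box q = \bigcap_(i in [set: 'I_d])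
      [set t : d.-tuple T | `|ratr (q.1 0 i) - tnth t i| < ratr q.2].
    apply/seteqP; split => t /=.
      by move=> bt i _ /=; have := bt i; rewrite mxE.
    by move=> bt i; have := bt i I; rewrite mxE.
  apply: fin_bigcap_measurable => // i _.
  rewrite (_ : [set t | _] = setT `&` (fun t : d.-tuple T => tnth t i) @^-1`
      `](ratr (q.1 0 i) - ratr q.2), (ratr (q.1 0 i) + ratr q.2)[); last first.
    rewrite setTI.
    by apply/seteqP; split => t /=; rewrite in_itv/= distrC ltr_distl.
  by apply: measurable_tnth.
(* Boxes that leave U are emptied, so that q ranges over a countable type. *)
pose F q := [set x | box q `<=` U /\ box q x].
have -> : U = \bigcup_q F q.
  apply/seteqP; split => [x Ux|x [q _ [qU qx]]]; last exact: qU.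
  have /nbhs_ballP[e /= e0 eU] : nbhs x U by apply: open_nbhs_nbhs.
  have [r] := @rat_in_itvoo R 0 (e / 2) (divr_gt0 e0 (ltr0Sn _ _)).
  rewrite in_itv/= => /andP[r0 re].
  have /choice[q qx] (i : 'I_d) : exists q : rat, `|ratr q - x 0 i| < ratr r.
    have [|q] := @rat_in_itvoo R (x 0 i - ratr r) (x 0 i + ratr r).
      by rewrite ltrBlDr -addrA ltrDl addr_gt0.
    by rewrite in_itv/= -ltr_distl => qx; exists q.
  exists (\row_i q i, r) => //; split; last by move=> i; rewrite mxE.
  move=> y yb; apply: eU; split=> // i j; rewrite ord1 /ball/=.
  have {yb} := yb j; rewrite mxE /= => yb.
  rewrite -(subrK (ratr (q j)) (x 0 j)) -addrA.
  rewrite (le_lt_trans (ler_normD _ _))// [ltRHS]splitr ltrD// ?(lt_trans yb)//.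
  by rewrite distrC (lt_trans (qx j)).
rewrite preimage_bigcup; apply: countable_bigcupT_measurable => [|q].
  exact: countableP.
have [qU|qU] := pselect (box q `<=` U).
  rewrite (_ : F q = box q); first exact: mbox.
  by apply/seteqP; split => [x []//|x]; split.
rewrite (_ : F q = set0) ?preimage_set0//.
by apply/seteqP; split => [x []|].
Qed.

Lemma measurable_continuous_row (f : Rd -> R) : continuous f ->
  measurable_fun setT (fun t : d.-tuple T => f (row_of_tuple t)).
Proof.
move=> /continuousP cf.
apply: (measurability _ (RGenOpens.measurableE R)).
move=> _ [_ [a [b ->] <-]]; rewrite setTI.
apply: (@measurable_row_of_tuple (f @^-1` `]a, b[%classic)).
exact/cf/interval_open.
Qed.

Lemma enorm_ge0 (x : Rd) : 0 <= enorm x.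
Proof. exact: sqrtr_ge0. Qed.

Lemma le_coord_enorm (x : Rd) i : x 0 i ^+ 2 <= enorm x ^+ 2.
Proof.
rewrite sqr_sqrtr; last by apply: sumr_ge0 => j _; rewrite sqr_ge0.
by rewrite (bigD1 i)//= lerDl sumr_ge0// => j _; rewrite sqr_ge0.
Qed.

(** Each factor 1 + x_i^2 is at most (1 + |x|)^2, and there are d of them. *)
Lemma decay_le_prod_oneDsqrV (t : d.-tuple T) (s : R) : s <= - (2 * d)%:R ->
  (1 + enorm (row_of_tuple t)) `^ s <= prod_oneDsqrV t.
Proof.
set e := enorm _ => sd; have e0 : 0 <= e := enorm_ge0 _.
have e1 : 1 <= 1 + e by rewrite lerDl.
apply: (le_trans (ler_powR e1 sd)).
rewrite powR_invn; last exact: le_trans e1.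
rewrite exprM /prod_oneDsqrV -exprVn -[X in _ ^+ X]card_ord -prodr_const.
apply: ler_prod => i _; rewrite invr_ge0 exprn_ge0/=; last exact: le_trans e1.
rewrite lef_pV2 ?posrE ?oneDsqr_gt0//; last first.
  by rewrite exprn_gt0// (lt_le_trans ltr01).
have := le_coord_enorm (row_of_tuple t) i; rewrite mxE -/e /oneDsqr => ie.
rewrite sqrrD expr1n mul1r -addrA lerD2l (le_trans ie)// lerDr.
by rewrite mulrn_wge0.
Qed.

Lemma L1_of_decay (f : Rd -> C) (K s : R) :
  (forall x, cdifferentiable f x) -> s <= - (2 * d)%:R ->
  (forall x, `|f x| <= (K * (1 + enorm x) `^ s)%:C) -> L1 f.
Proof.
move=> df sd fK.
have K0 : 0 <= K.
  have := le_trans (normr_ge0 _) (fK 0); rewrite ler0c pmulr_lge0//.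
  by rewrite powR_gt0// ltr_wpDr ?enorm_ge0.
have intK : (@lebesgue_tuple R d).-integrable setT
    (fun t => (K * prod_oneDsqrV t)%:E).
  under eq_fun do rewrite EFinM.
  by apply: integrableZl => //; exact: integrable_prod_oneDsqrV.
have bound (t : d.-tuple T) :
    K * (1 + enorm (row_of_tuple t)) `^ s <= K * prod_oneDsqrV t.
  by rewrite ler_wpM2l// decay_le_prod_oneDsqrV.
have bRe (z : C) (M : R) : `|z| <= M%:C -> `|complex.Re z| <= M.
  rewrite normc_def lecR; apply: le_trans.
  by rewrite -sqrtr_sqr ler_sqrt ?lerDl ?sqr_ge0// addr_ge0 ?sqr_ge0.
have bIm (z : C) (M : R) : `|z| <= M%:C -> `|complex.Im z| <= M.
  rewrite normc_def lecR; apply: le_trans.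
  by rewrite -sqrtr_sqr ler_sqrt ?lerDr ?sqr_ge0// addr_ge0 ?sqr_ge0.
split; apply: le_integrable intK => //.
- apply/measurable_EFinP.
  apply: (@measurable_continuous_row (fun x => complex.Re (f x))) => x.
  exact: differentiable_continuous (df x).1.
- move=> t _; rewrite lee_fin; apply: le_trans (ler_norm _).
  exact: le_trans (bRe _ _ (fK _)) (bound t).
- apply/measurable_EFinP.
  apply: (@measurable_continuous_row (fun x => complex.Im (f x))) => x.
  exact: differentiable_continuous (df x).2.
- move=> t _; rewrite lee_fin; apply: le_trans (ler_norm _).
  exact: le_trans (bIm _ _ (fK _)) (bound t).
Qed.

End integrability.

(** * Functions that are homogeneous outside the unit ball *)

Section symbols.
Context {R : realType} {d : nat}.
Local Notation C := R[i].
Local Notation Rd := 'rV[R]_d.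
Implicit Types (f g h G : Rd -> C) (i : 'I_d) (a : C) (chi : Rd -> R).

Lemma enormZ (t : R) (x : Rd) : 0 <= t -> enorm (t *: x) = t * enorm x.
Proof.
move=> t0; rewrite /enorm.
under eq_bigr => i _ do rewrite mxE exprMn.
by rewrite -mulr_sumr sqrtrM ?sqr_ge0// sqrtr_sqr ger0_norm.
Qed.

Lemma enorm0 : enorm (0 : Rd) = 0.
Proof. by rewrite -(scale0r (0 : Rd)) enormZ// mul0r. Qed.

Lemma open_enorm_gt (r : R) : open [set x : Rd | r < enorm x].
Proof.
have : continuous (@enorm R d).
  move=> x; apply: continuous_comp; last exact: sqrt_continuous.
  apply: (@continuous_big _ _ _ _ _ _ _ _ (fun i (y : Rd) => y 0 i ^+ 2)).
    exact: add_continuous.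
  move=> i _ y; apply: (@continuous_comp _ _ _
    (fun y : Rd => y 0 i) (fun u => u ^+ 2)).
    exact: coord_continuous.
  exact: exprn_continuous.
move=> /continuousP/(_ [set u | r < u] (@open_gt _ r)).
by [].
Qed.

Lemma bounded_on_balls g (r : R) : (forall x, cdifferentiable g x) ->
  exists M : R, forall x, enorm x <= r -> `|g x| <= M%:C.
Proof.
move=> dg.
pose F (x : Rd) : R := `|complex.Re (g x)| + `|complex.Im (g x)|.
have cF : continuous F.
  move=> x; have [dr di] := dg x.
  have cr := cvg_norm (differentiable_continuous dr).
  have ci := cvg_norm (differentiable_continuous di).
  exact: (cvgD (cr _) (ci _)).
pose A : set Rd := [set x | forall i, `[- r, r]%classic (x ord0 i)].
have [r0|r0] := ltP r 0.
  by exists 0 => x /le_lt_trans/(_ r0); rewrite ltNge enorm_ge0.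
have cA : compact A.
  apply: (@rV_compact _ _ (fun=> `[- r, r]%classic)) => _.
  exact: segment_compact.
have [|c _ cm] := @EVT_max_rV _ _ F A _ cA (continuous_subspaceT cF).
  by exists 0 => i; rewrite /= mxE in_itv/= oppr_le0 r0.
exists (F c) => x xr.
have /mem_set/cm xc : A x.
  move=> i; rewrite /= in_itv/= -ler_norml -(ler_pXn2r (n := 2))// ?nnegrE//.
  rewrite real_normK ?num_real//; apply: le_trans (le_coord_enorm x i) _.
  by rewrite ler_pXn2r// nnegrE// enorm_ge0.
apply: (@le_trans _ _ ((F x)%:C)); last by rewrite lecR.
rewrite {1}(complexE (g x)) (le_trans (ler_normD _ _))// normrM.
rewrite !normc_def /= !expr0n/= !addr0 !add0r expr1n sqrtr1 mul1r !sqrtr_sqr.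
by rewrite -rmorphD.
Qed.

Lemma size_mpartial_seq (b : 'I_d -> nat) :
  size (flatten [seq nseq (b i) i | i <- enum 'I_d]) = mdegree b.
Proof.
rewrite size_flatten /shape -map_comp sumnE big_map big_enum /=.
by apply: eq_bigr => i _; rewrite size_nseq.
Qed.

(** The ratio of two comparable quantities contributes only a constant when
    raised to a power of either sign. *)
Lemma powR_bounded_below (u s : R) : 1 <= u <= 3 -> 3 `^ (- `|s|) <= u `^ s.
Proof.
move=> /andP[u1 u3]; apply: (@le_trans _ _ (u `^ (- `|s|))).
  have u0 := lt_le_trans ltr01 u1.
  rewrite !powRN lef_pV2 ?posrE ?powR_gt0//.
  by apply: ge0_ler_powR; rewrite ?nnegrE// ltW.
by apply: ler_powR => //; rewrite lerNl -normrN ler_norm.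
Qed.

(** A partial derivative of G of order k is bounded on the ball of radius 2 by
    compactness.  Outside of it, it is homogeneous of degree a - k, so that its
    value at x is (|x| / 2)^(a - k) times its value at a point of the sphere of
    radius 2; and |x| / 2 is comparable with 1 + |x|. *)
Lemma homogeneous_tail_symbol a G h : smooth G ->
  smooth_on [set x | x != 0] h -> pos_homogeneous a h ->
  (forall x, 1 < enorm x -> G x = h x) -> symbol a G.
Proof.
move=> sG sh hh Gh; split=> // b; rewrite /mpartial.
rewrite -(size_mpartial_seq b); set l := flatten _.
have sl := smooth_on_partials l sG.
have tl (x : Rd) : 1 < enorm x -> partials l G x = partials l h x.
  have E : {in [set y : Rd | 1 < enorm y], G =1 h}.
    by move=> y /set_mem; exact: Gh.
  by move=> x1; exact: (eq_on_partials l (@open_enorm_gt 1) E (mem_set x1)).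
have [|M Mb] := @bounded_on_balls (partials l G) 2.
  by move=> x; exact: smooth_on_cdiff sl _ _.
set s := complex.Re a - _.
have M0 : 0 <= M.
  have := Mb 0; rewrite enorm0 => /(_ (ltW (ltr0Sn _ _))).
  move=> /(le_trans (normr_ge0 _)).
  by rewrite ler0c.
(* One radial scale t for both regions: t = 1 in the ball of radius 2, and
   t = |x| / 2 outside of it. *)
have key x : exists t : R, [/\ 0 < t, 1 <= (1 + enorm x) / t <= 3 &
    `|partials l G x| <= (t `^ s * M)%:C].
  have e0 := enorm_ge0 x.
  have [x2|x2] := leP (enorm x) 2.
    exists 1; split=> //; first by rewrite divr1; lra.
    by rewrite powR1 mul1r Mb.
  have t0 : 0 < enorm x / 2 by lra.
  exists (enorm x / 2); split=> //.
    by rewrite ler_pdivlMr// ler_pdivrMr//; lra.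
  set t := enorm x / 2; pose y := t^-1 *: x.
  have y2 : enorm y = 2.
    rewrite /y enormZ ?invr_ge0 ?ltW// /t invf_div mulrAC mulfK// gt_eqF//; lra.
  have xy : x = t *: y by rewrite /y scalerA divff ?scale1r// gt_eqF.
  have y0 : y != 0.
    by apply/eqP => y0; move: y2; rewrite y0 enorm0; lra.
  rewrite tl; last by lra.
  rewrite xy (pos_homogeneous_partials l sh hh t0 y0) -tl; last first.
    by rewrite y2; lra.
  rewrite normrM norm_cpow rmorphM/=; apply: ler_pM => //.
  - by rewrite ler0c powR_ge0.
  - rewrite lecR le_eqVlt; apply/orP; left; apply/eqP; congr (_ `^ _).
    by rewrite /s; case: (a) => u v; rewrite raddfB/= ?raddfMn/=.
  - by rewrite Mb// y2.
exists (M / 3 `^ (- `|s|)) => x; have [t [t0 /powR_bounded_below tx]] := key x.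
move=> /le_trans; apply; rewrite lecR mulrAC ler_pdivlMr ?powR_gt0//.
have -> : 1 + enorm x = t * ((1 + enorm x) / t).
  by rewrite mulrC divfK// gt_eqF.
have e0 := enorm_ge0 x.
rewrite powRM ?(ltW t0) ?divr_ge0 ?(ltW t0)//; last by lra.
rewrite [_ * M]mulrC -!mulrA ler_wpM2l// ler_wpM2l ?powR_ge0//.
Qed.

(** The product vanishes near the origin, where h may be singular. *)
Lemma smooth_cutoffM chi h : cutoff chi -> smooth_on [set x | x != 0] h ->
  smooth (fun x => (chi x)%:C * h x).
Proof.
move=> [schi chi0 _] sh.
pose U := interior [set x : Rd | chi x = 0].
have oU : open U by exact: open_interior.
apply: (@smooth_cover _ _ U [set x | x != 0]).
- apply/seteqP; split=> // x _; have [->|x0] := eqVneq x 0; last by right.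
  by left; rewrite /U /interior.
- apply: (@eq_on_smooth _ _ _ (fun=> 0)) => //; last exact: smooth_on_cst.
  by move=> x /set_mem/interior_subset/= ->; rewrite mul0r.
- apply: smooth_onM => //; first exact: open_neq0.
  exact: smooth_onW schi.
Qed.

Lemma cutoffM_tail chi h (x : Rd) : cutoff chi -> 1 < enorm x ->
  (chi x)%:C * h x = h x.
Proof. by move=> [_ _ chi1] x1; rewrite chi1 ?mul1r// ltW. Qed.

Lemma pos_homogeneous0 a : pos_homogeneous a (fun _ : Rd => 0).
Proof. by move=> t x _ _; rewrite mulr0. Qed.

Lemma smooth_on_scale (U : set Rd) (c : C) f : open U -> smooth_on U f ->
  smooth_on U (fun x => c * f x).
Proof. by move=> oU sf; apply: smooth_onM => //; exact: smooth_on_cst. Qed.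

(** The expansion of G has the single term chi h: the difference G - chi h
    vanishes outside the unit ball, and 0 is homogeneous of every degree, so
    that the difference is a symbol of every order. *)
Lemma homogeneous_tail_classical chi a G h : cutoff chi -> smooth G ->
  smooth_on [set x | x != 0] h -> pos_homogeneous a h ->
  (forall x, 1 < enorm x -> G x = h x) -> classical_symbol a G.
Proof.
move=> cchi sG sh hh Gh.
exists chi, (fun j : nat => (if j is 0 then h else fun=> 0) : Rd -> C).
split=> //.
  case=> [|j]; split=> //; rewrite ?subr0//.
  - exact: smooth_on_cst.
  - exact: pos_homogeneous0.
case=> [|N].
  rewrite subr0 (_ : (fun x => _) = G).
    exact: homogeneous_tail_symbol hh Gh.
  by apply/funext => x; rewrite big_ord0 subr0.
rewrite (_ : (fun x => _) = (fun x => G x + (-1) * ((chi x)%:C * h x))).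
  apply: (@homogeneous_tail_symbol _ _ (fun=> 0)).
  - apply: smooth_onD => //; first exact: openT.
    by apply: smooth_on_scale; [exact: openT|exact: smooth_cutoffM].
  - exact: smooth_on_cst.
  - exact: pos_homogeneous0.
  - by move=> x x1; rewrite cutoffM_tail// Gh// mulN1r subrr.
apply/funext => x; rewrite big_ord_recl big1 ?addr0 ?mulN1r//.
by move=> j _; rewrite mulr0.
Qed.

(** The expansion of the remainder is the expansion of s, shifted by N. *)
Lemma classical_remainder a (s : Rd -> C) chi (f : nat -> Rd -> C) (N : nat) :
  cutoff chi ->
  (forall j, smooth_on [set x | x != 0] (f j) /\
             pos_homogeneous (a - j%:R) (f j)) ->
  (forall M, symbol (a - M%:R)
     (fun x => s x - \sum_(j < M) (chi x)%:C * f j x)) ->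
  classical_symbol (a - N%:R) (fun x => s x - \sum_(j < N) (chi x)%:C * f j x).
Proof.
move=> cchi hf sf; exists chi, (fun j => f (N + j)%N); split=> // [j|M].
  by have := hf (N + j)%N; rewrite natrD opprD addrA.
have := sf (N + M)%N; rewrite natrD opprD addrA; congr (symbol _ _).
by apply/funext => x; rewrite big_split_ord /= opprD addrA.
Qed.

Lemma L1_mpartial a (s : Rd -> C) (b : 'I_d -> nat) : symbol a s ->
  complex.Re a - (mdegree b)%:R <= - (2 * d)%:R -> L1 (mpartial b s).
Proof.
move=> [ss /(_ b)[K sK]] ab; apply: L1_of_decay ab sK => x.
exact: smooth_on_cdiff (smooth_on_partials _ ss) _ _.
Qed.

End symbols.

(** * Taylor expansions along integer multiples of a basis vector *)

Section taylor.
Context {R : realType} {d : nat}.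
Local Notation C := R[i].
Local Notation Rd := 'rV[R]_d.
Implicit Types (i : 'I_d) (l : (Rd -> C) -> C).

Lemma poly_vanishing_on_nat (p : {poly C}) :
  (forall k : nat, p.[k%:R] = 0) -> p = 0.
Proof.
move=> pk; apply/eqP; apply: contraT => p0.
pose rs : seq C := [seq k%:R | k <- iota 0 (size p)].
have /max_poly_roots/(_ _ _) : p != 0 by [].
move=> /(_ rs); rewrite size_map size_iota ltnn; apply.
  by apply/allP => _ /mapP[k _ ->]; apply/eqP; exact: pk.
rewrite map_inj_uniq ?iota_uniq// => m n /eqP.
by rewrite eqr_nat => /eqP.
Qed.

Lemma taylor_coefZ (k : R) (p : Rd) (b : 'I_d -> nat) :
  taylor_coef (k *: p) b = (k ^+ mdegree b)%:C * taylor_coef p b.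
Proof.
rewrite /taylor_coef -rmorphM/= mulrA; congr ((_ / _)%:C).
rewrite /mpower /mdegree -prodrXr -big_split/=.
by apply: eq_bigr => i _; rewrite mxE exprMn.
Qed.

Lemma mpartial_single i (b : 'I_d -> nat) (s : Rd -> C) :
  (forall j, b j = (j == i)) -> mpartial b s = partial i s.
Proof.
move=> bi; rewrite /mpartial.
rewrite (_ : flatten _ = [:: i])//.
rewrite -(filter_pred1_uniq (enum_uniq 'I_d) (mem_enum _ i)).
elim: (enum 'I_d) => //= j r ->; rewrite bi.
by case: (j == i).
Qed.

Lemma taylor_coef_unit0 i (b : 'I_d -> nat) : mdegree b = 1%N ->
  b i != 1%N -> taylor_coef (delta_mx 0 i : Rd) b = 0.
Proof.
move=> b1 bi.
suff [j /andP[ji bj]] : exists j, (j != i) && (b j != 0%N).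
  by rewrite /taylor_coef /mpower (bigD1 j)//= mxE (negbTE ji) andbF expr0n
    (negbTE bj) mul0r mul0r.
apply/existsP; apply: contraT => /existsPn b0; move: bi.
suff : mdegree b = b i by rewrite b1 => <-.
rewrite /mdegree (bigD1 i)//= big1 ?addn0// => j ji.
by have := b0 j; rewrite ji /= negbK => /eqP.
Qed.

(** At p = k e_i the difference of the two invariance identities is the value at
    k of a polynomial whose coefficient of degree m is the difference of the two
    forms at the m-th derivative in direction i, divided by m!. *)
Lemma partial_of_invariance (rho l1 l2 : (Rd -> C) -> C) (s : Rd -> C)
    (N : nat) i :
  translation_invariant integer_lattice rho l1 ->
  translation_invariant integer_lattice rho l2 ->
  CS_nonint s -> (0 < N)%N ->
  (forall b : 'I_d -> nat, mdegree b = N.+1 -> L1 (mpartial b s)) ->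
  l1 (partial i s) = l2 (partial i s).
Proof.
move=> inv1 inv2 Ss N0 sL1.
pose e : Rd := delta_mx 0 i.
pose D (b : {ffun 'I_d -> 'I_N.+1}) : C :=
  (l1 (mpartial (mindex b) s) - l2 (mpartial (mindex b) s))
  * taylor_coef e (mindex b).
pose P (b : {ffun 'I_d -> 'I_N.+1}) :=
  (0 < mdegree (mindex b))%N && (mdegree (mindex b) <= N)%N.
pose p : {poly C} := \sum_(b | P b) D b *: 'X^(mdegree (mindex b)).
have p0 : p = 0.
  apply: poly_vanishing_on_nat => k.
  have kG : integer_lattice (k%:R *: e).
    by move=> j; rewrite !mxE rpredM// ?rpred_nat//.
  have := inv1 s N _ Ss sL1 kG; have := inv2 s N _ Ss sL1 kG.
  move=> /eqP; rewrite addr_eq0 => /eqP E2 /eqP; rewrite addr_eq0 -E2 => /eqP E.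
  rewrite /p horner_sum; apply/eqP; move: E => /eqP; rewrite -subr_eq0.
  rewrite /taylor_sum -sumrB; congr (_ == _).
  apply: eq_bigr => b _; rewrite -mulrBl taylor_coefZ hornerZ hornerXn.
  by rewrite rmorphXn/= rmorph_nat mulrCA [RHS]mulrC.
(* Among the multiindices of degree 1, only that of d_i has a nonzero Taylor
   coefficient at e_i. *)
have : p`_1 = 0 by rewrite p0 coef0.
have bi1 : (1 < N.+1)%N by [].
pose bi : {ffun 'I_d -> 'I_N.+1} :=
  [ffun j => if j == i then Ordinal bi1 else ord0].
have biE j : mindex bi j = (j == i).
  by rewrite /mindex ffunE; case: (j == i).
have bid : mdegree (mindex bi) = 1%N.
  rewrite /mdegree (eq_bigr (fun j => nat_of_bool (j == i))); last first.
    by move=> j _; exact: biE.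
  by rewrite (bigD1 i)//= eqxx big1// => j /negbTE ->.
rewrite /p coef_sum (bigD1 bi)/=; last by rewrite /P bid.
rewrite coefZ coefXn bid eqxx mulr1 big1 ?addr0 => [|b /andP[_ bbi]].
  rewrite /D (mpartial_single _ biE).
  rewrite (_ : taylor_coef _ _ = 1) ?mulr1.
    by move/eqP; rewrite subr_eq0 => /eqP.
  rewrite /taylor_coef /mpower /mfact.
  by rewrite !big1 ?divr1// => j _; rewrite biE ?mxE; case: (j == i).
rewrite coefZ coefXn.
have [b1|] := eqVneq 1%N (mdegree (mindex b)); last by rewrite mulr0.
rewrite /D taylor_coef_unit0 ?mulr0 ?mul0r//.
apply: contra_neq bbi => bi1'; apply/ffunP => j; apply/val_inj.
have bE : \sum_(k | k != i) mindex b k = 0%N.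
  by move: b1; rewrite /mdegree (bigD1 i)//= bi1' add1n => -[].
have [->|ji] := eqVneq j i.
  by rewrite ffunE eqxx.
rewrite ffunE (negbTE ji) /=; move/eqP: bE.
rewrite sum_nat_eq0 => /forallP/(_ j).
by rewrite ji => /eqP.
Qed.

End taylor.

(** * Uniqueness of the invariant extension *)

Section uniqueness.
Context {R : realType} {d : nat}.
Local Notation C := R[i].
Local Notation Rd := 'rV[R]_d.
Implicit Types (i : 'I_d) (a : C).

Definition nonint a := ~ (exists k : int, a = k%:~R).

Lemma nonintD a (k : int) : nonint a -> nonint (a + k%:~R).
Proof.
move=> na [m am]; apply: na; exists (m - k).
by rewrite rmorphB/= -am addrK.
Qed.

Lemma nonintDn a (n : nat) : nonint a -> nonint (a + n%:R).
Proof. exact: (@nonintD a n). Qed.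

Lemma nonintBn a (n : nat) : nonint a -> nonint (a - n%:R).
Proof. by move=> /(@nonintD _ (- n%:Z)); rewrite rmorphN/=. Qed.

Lemma nonint_Im a : complex.Im a != 0 -> nonint a.
Proof.
move=> a0 [k ak]; move: a0; rewrite ak.
by rewrite -(rmorph_int (real_complex R)) /= eqxx.
Qed.

Lemma linear_form_onD (A : set (Rd -> C)) l (c1 c2 : C) (f1 f2 : Rd -> C) :
  linear_form_on A l -> A f1 -> A f2 -> A (fun x => c1 * f1 x + c2 * f2 x) ->
  l (fun x => c1 * f1 x + c2 * f2 x) = c1 * l f1 + c2 * l f2.
Proof.
move=> lin Af1 Af2 A12.
have := lin 2%N (fun k => if k == ord0 then c1 else c2)
  (fun k => if k == ord0 then f1 else f2).
rewrite !big_ord_recl big_ord0 addr0/=.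
rewrite (_ : (fun x => \sum_k _) = (fun x => c1 * f1 x + c2 * f2 x)); last first.
  by apply/funext => x; rewrite !big_ord_recl big_ord0 addr0.
by apply=> // k; case: ifP.
Qed.

Lemma linear_form_on_sum (A : set (Rd -> C)) l n (f : 'I_n -> Rd -> C) :
  linear_form_on A l -> (forall k, A (f k)) -> A (fun x => \sum_k f k x) ->
  l (fun x => \sum_k f k x) = \sum_k l (f k).
Proof.
move=> lin Af As.
have := lin n (fun=> 1) f Af.
under eq_fun do under eq_bigr do rewrite mul1r.
by under [in RHS]eq_bigr do rewrite mul1r; apply.
Qed.

Context (rho l1 l2 : (Rd -> C) -> C)
  (lin1 : linear_form_on CS_nonint l1) (lin2 : linear_form_on CS_nonint l2)
  (rho1 : forall s, CS_nonint s -> CS_lt_mdim s -> l1 s = rho s)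
  (rho2 : forall s, CS_nonint s -> CS_lt_mdim s -> l2 s = rho s)
  (inv1 : translation_invariant integer_lattice rho l1)
  (inv2 : translation_invariant integer_lattice rho l2).

(** The number N of derivatives is taken so large that they are integrable. *)
Lemma invariant_eq_partial (s : Rd -> C) a i :
  nonint a -> classical_symbol a s ->
  l1 (partial i s) = l2 (partial i s).
Proof.
move=> na sa.
have ss : symbol a s.
  have [chi [f [_ _ /(_ 0%N)]]] := sa; rewrite subr0; congr (symbol _ _).
  by apply/funext => x; rewrite big_ord0 subr0.
pose N := Num.bound `|complex.Re a + (2 * d)%:R|.
have bN : complex.Re a + (2 * d)%:R <= N%:R.
  exact: le_trans (ler_norm _) (ltW (archi_boundP (normr_ge0 _))).
apply: (@partial_of_invariance _ _ rho _ _ s N.+1) => //; first by exists a.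
move=> b bN1; apply: L1_mpartial ss _; rewrite bN1.
rewrite lerBlDr addrC lerBrDr (le_trans bN)// ler_nat.
by rewrite leqW// leqW.
Qed.

(** In the notation of the proof, (a + d) chi h = S - K, where S is a sum of
    derivatives of classical symbols of order a + 1, and K vanishes outside the
    unit ball by Euler's identity. *)
Lemma invariant_eq_cutoffM a (chi : Rd -> R) (h : Rd -> C) : nonint a ->
  cutoff chi -> smooth_on [set x | x != 0] h -> pos_homogeneous a h ->
  l1 (fun x => (chi x)%:C * h x) = l2 (fun x => (chi x)%:C * h x).
Proof.
move=> na cchi sh hh.
pose g i : Rd -> C := fun x => (x 0 i)%:C * h x.
pose G i : Rd -> C := fun x => (chi x)%:C * g i x.
have sg i : smooth_on [set x | x != 0] (g i).
  by apply: smooth_onM => //; [exact: open_neq0|exact: smooth_on_coord].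
have hg i : pos_homogeneous (a + 1) (g i) by exact: pos_homogeneous_coord.
have sG i : smooth (G i) by exact: smooth_cutoffM.
have Gg i x : 1 < enorm x -> G i x = g i x by exact: cutoffM_tail.
have clG i : classical_symbol (a + 1) (G i).
  exact: (homogeneous_tail_classical cchi (sG i) (sg i) (hg i) (Gg i)).
have hdg i : pos_homogeneous a (partial i (g i)).
  by have := pos_homogeneous_partial i (sg i) (hg i); rewrite addrK.
have dGg i x : 1 < enorm x -> partial i (G i) x = partial i (g i) x.
  have E : {in [set y : Rd | 1 < enorm y], G i =1 g i}.
    by move=> y /set_mem; exact: Gg.
  move=> x1.
  exact: (eq_on_partials [:: i] (@open_enorm_gt _ _ 1) E (mem_set x1)).
have cldG i : classical_symbol a (partial i (G i)).
  apply: (homogeneous_tail_classical cchi _ _ (hdg i) (dGg i)).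
    exact: smooth_on_partial (sG i).
  exact: smooth_on_partial (sg i).
have ad0 : a + d%:R != 0.
  apply/eqP => ad; apply: (nonintDn (n := d) na); exists 0; rewrite ad.
  by rewrite mulr0z.
have tail0 x : 1 < enorm x -> x != 0.
  by apply: contraTneq => ->; rewrite enorm0 -leNgt.
pose S : Rd -> C := fun x => \sum_i partial i (G i) x.
have St x : 1 < enorm x -> S x = (a + d%:R) * h x.
  move=> x1; rewrite /S (eq_bigr (fun i => partial i (g i) x)) => [|i _].
    by rewrite (euler_divergence sh hh)// tail0.
  exact: dGg.
have sS : smooth S.
  apply: smooth_on_sum => [|i]; first exact: openT.
  exact: smooth_on_partial (sG i).
have clS : classical_symbol a S.
  apply: (homogeneous_tail_classical cchi sS _ _ St).
    by apply: smooth_on_scale => //; exact: open_neq0.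
  by move=> t x t0 x0; rewrite hh// mulrCA.
have clh : classical_symbol a (fun x => (chi x)%:C * h x).
  apply: (homogeneous_tail_classical cchi _ sh hh).
    exact: smooth_cutoffM.
  by move=> x; exact: cutoffM_tail.
pose K : Rd -> C := fun x => S x + (- (a + d%:R)) * ((chi x)%:C * h x).
have sK : smooth K.
  apply: smooth_onD => //; first exact: openT.
  by apply: smooth_on_scale; [exact: openT|exact: smooth_cutoffM].
(* K has every order; this one is not an integer and has real part below -d. *)
pose b : C := (- d%:R - 1) +i* 1.
have clK : classical_symbol b K.
  apply: (homogeneous_tail_classical (h := fun=> 0) cchi sK).
  - exact: smooth_on_cst.
  - exact: pos_homogeneous0.
  - by move=> x x1; rewrite /K St// cutoffM_tail// mulNr subrr.
have nb : nonint b by apply: nonint_Im; rewrite oner_eq0.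
have KN : CS_nonint K by exists b.
have lK : l1 K = l2 K.
  have KL : CS_lt_mdim K by exists b => //=; rewrite ltrBlDr ltrDl.
  by rewrite rho1// rho2.
have SN : CS_nonint S by exists a.
have lS : l1 S = l2 S.
  have dGN i : CS_nonint (partial i (G i)) by exists a.
  have lS1 : l1 S = \sum_i l1 (partial i (G i)).
    exact: linear_form_on_sum lin1 dGN SN.
  have lS2 : l2 S = \sum_i l2 (partial i (G i)).
    exact: linear_form_on_sum lin2 dGN SN.
  rewrite lS1 lS2; apply: eq_bigr => i _.
  exact: invariant_eq_partial (nonintDn (n := 1) na) (clG i).
have E : (fun x => (chi x)%:C * h x) =
    (fun x => (a + d%:R)^-1 * S x + (- (a + d%:R)^-1) * K x).
  apply/funext => x; rewrite /K mulrDr addrA mulNr subrr add0r mulrA mulrNN.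
  by rewrite mulVf// mul1r.
have N : CS_nonint (fun x => (chi x)%:C * h x) by exists a.
rewrite E in N *.
by rewrite (linear_form_onD lin1 SN KN N) (linear_form_onD lin2 SN KN N) lK lS.
Qed.

(** Descending induction on the number N of homogeneous terms removed from s:
    for large N the remainder has order less than -d, and two consecutive
    remainders differ by a term chi h. *)
Lemma invariant_eq (s : Rd -> C) : CS_nonint s -> l1 s = l2 s.
Proof.
move=> [a na [chi [f [cchi hf sf]]]].
pose r N : Rd -> C := fun x => s x - \sum_(j < N) (chi x)%:C * f j x.
have clr N : classical_symbol (a - N%:R) (r N).
  exact: classical_remainder hf sf.
have rN N : CS_nonint (r N) by exists (a - N%:R); [exact: nonintBn|].
have step N : l1 (r N.+1) = l2 (r N.+1) -> l1 (r N) = l2 (r N).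
  move=> lr.
  have [sfN hfN] := hf N.
  have lh := invariant_eq_cutoffM (nonintBn (n := N) na) cchi sfN hfN.
  have hN : CS_nonint (fun x => (chi x)%:C * f N x).
    exists (a - N%:R); first exact: nonintBn.
    apply: (homogeneous_tail_classical cchi _ sfN hfN).
      exact: smooth_cutoffM.
    by move=> x; exact: cutoffM_tail.
  have E : r N = fun x => 1 * ((chi x)%:C * f N x) + 1 * r N.+1 x.
    apply/funext => x; rewrite /r big_ord_recr/= !mul1r; ring.
  have := rN N; rewrite E => rNN.
  have rN1 := rN N.+1.
  rewrite (linear_form_onD lin1 hN rN1 rNN) (linear_form_onD lin2 hN rN1 rNN).
  by rewrite lh lr.
have base : exists N, l1 (r N) = l2 (r N).
  pose N := Num.bound `|complex.Re a + d%:R|.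
  have bN : complex.Re a + d%:R < N%:R.
    exact: le_lt_trans (ler_norm _) (archi_boundP (normr_ge0 _)).
  exists N; have rL : CS_lt_mdim (r N).
    exists (a - N%:R) => //.
    have -> : complex.Re (a - N%:R) = complex.Re a - N%:R.
      by case: (a) => u v; rewrite raddfB/= ?raddfMn/=.
    by rewrite ltrBlDr addrC ltrBrDr.
  by rewrite rho1// rho2.
have -> : s = r 0%N by apply/funext => x; rewrite /r big_ord0 subr0.
by have [N] := base; elim: N => // N IH /step.
Qed.

End uniqueness.

Theorem theorem1 (R : realType) (d : nat)
    (rho : ('rV[R]_d -> R[i]) -> R[i]) :
  linear_form_L1 rho -> taylor_compatible rho ->
  forall lambda1 lambda2 : ('rV[R]_d -> R[i]) -> R[i],
  linear_form_on CS_nonint lambda1 -> linear_form_on CS_nonint lambda2 ->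
  (forall s, CS_nonint s -> CS_lt_mdim s -> lambda1 s = rho s) ->
  (forall s, CS_nonint s -> CS_lt_mdim s -> lambda2 s = rho s) ->
  (translation_invariant integer_lattice rho lambda1 /\
   translation_invariant integer_lattice rho lambda2) \/
  (translation_invariant setT rho lambda1 /\
   translation_invariant setT rho lambda2) ->
  forall s, CS_nonint s -> lambda1 s = lambda2 s.
Proof.
move=> _ _ l1 l2 lin1 lin2 rho1 rho2 inv.
have [inv1 inv2] : translation_invariant integer_lattice rho l1 /\
    translation_invariant integer_lattice rho l2.
  case: inv => // -[inv1 inv2]; split=> s N p Ss sL1 _.
    exact: inv1.
  exact: inv2.
exact: (invariant_eq lin1 lin2 rho1 rho2 inv1 inv2).
Qed.
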